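(* Let $G$ be a countable amenable group and let $(\mathcal{H},\pi)$ be a unitary representation of $G$ with pure point spectrum. Then every left Følner sequence $(F_n)$ in $G$ is a strong sequence for $(\mathcal{H},\pi)$, that is, for every $v\in\mathcal{H}$, $$\lim_n \frac{1}{|F_n|}\sum_{s\in F_n}\pi(s)v=P_Gv$$ in the norm topology on $\mathcal{H}$.
   Context: $P_G$ denotes the orthogonal projection onto the closed subspace of $\pi(G)$-invariant vectors. A sequence $(F_n)$ of (nonempty) finite subsets of $G$ is a left Følner sequence if $\lim_n |F_n\triangle tF_n|/|F_n|=0$ for all $t\in G$. A unitary representation $(\mathcal{H},\pi)$ has pure point spectrum if $\mathcal{H}$ is the closed linear span of the vectors $v\in\mathcal{H}$ whose cyclic linear span $\mathrm{span}\{\pi(g)v : g\in G\}$ is finite-dimensional. *)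

(* Defs.v *)
From HB Require Import structures.
From mathcomp Require Import all_boot all_order all_algebra.
From mathcomp Require Import finmap.
From mathcomp Require Import all_classical all_reals all_analysis.
From mathcomp Require Import complex.

Set Implicit Arguments.
Unset Strict Implicit.
Unset Printing Implicit Defensive.

Import Order.TTheory GRing.Theory Num.Theory.
Import numFieldNormedType.Exports.

Local Open Scope classical_set_scope.
Local Open Scope fset_scope.
Local Open Scope ring_scope.

Section Amenability.
Variables (R : realType) (G : groupType).

Definition bounded_on_group (f : G -> R) : Prop :=
  exists M : R, forall g, `|f g| <= M.

(* [m] is a left-invariant mean on l^oo(G); its values on unbounded
   functions are unconstrained. *)
Definition left_invariant_mean (m : (G -> R) -> R) : Prop :=
  [/\ forall (a : R) (f h : G -> R),
        bounded_on_group f -> bounded_on_group h ->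
        m (fun g => a * f g + h g) = a * m f + m h,
      forall f : G -> R, bounded_on_group f -> (forall g, 0 <= f g) -> 0 <= m f,
      m (fun=> 1) = 1 &
      forall (t : G) (f : G -> R), bounded_on_group f ->
        m (fun g => f (t * g)%g) = m f].

Definition amenable : Prop := exists m, left_invariant_mean m.

Definition left_translate (t : G) (A : {fset G}) : {fset G} :=
  [fset (t * s)%g | s in A].

Definition fsymdiff (A B : {fset G}) : {fset G} := (A `\` B) `|` (B `\` A).

Definition left_folner (F : nat -> {fset G}) : Prop :=
  (forall n, F n != fset0) /\
  forall t : G,
    (#|` fsymdiff (F n) (left_translate t (F n))|%:R / #|` F n|%:R : R)
      @[n --> \oo] --> (0 : R).

End Amenability.

Section LinearSpan.
Variables (K : numFieldType) (V : lmodType K).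

Definition linear_span (A : set V) : set V :=
  [set v | exists s : seq (K * V),
     (forall p, p \in s -> A p.2) /\ v = \sum_(p <- s) p.1 *: p.2].

Definition finite_dimensional (E : set V) : Prop :=
  exists s : seq V, E = linear_span [set` s].

End LinearSpan.

Section UnitaryRepresentations.
Variables (R : realType) (G : groupType) (H : completeNormedModType R[i]).
Variable dot : {dot H for @Num.conj R[i]}.

(* A Hilbert space is a complete normed space over R[i] whose norm is induced
   by [dot], which is linear in its first argument. *)
Definition hilbert_space : Prop := forall v : H, `|v| ^+ 2 = dot v v.

Definition unitary_operator (U : {linear H -> H}) : Prop :=
  bijective U /\ forall u v, dot (U u) (U v) = dot u v.

Definition unitary_representation (pi : G -> {linear H -> H}) : Prop :=
  [/\ forall g, unitary_operator (pi g),
      forall v, pi 1%g v = v &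
      forall g h v, pi (g * h)%g v = pi g (pi h v)].

(* When [E] is a closed subspace of a Hilbert space, the set below has exactly
   one element; [get] returns it. *)
Definition orthogonal_projection (E : set H) (v : H) : H :=
  get [set u | E u /\ forall w, E w -> dot (v - u) w = 0].

Definition invariant_vectors (pi : G -> {linear H -> H}) : set H :=
  [set v | forall g, pi g v = v].

Definition cyclic_span (pi : G -> {linear H -> H}) (v : H) : set H :=
  linear_span [set pi g v | g in [set: G]].

Definition pure_point_spectrum (pi : G -> {linear H -> H}) : Prop :=
  closure (linear_span [set v | finite_dimensional (cyclic_span pi v)])
    = [set: H].

Definition strong_sequence (pi : G -> {linear H -> H})
    (F : nat -> {fset G}) : Prop :=
  forall v : H,
    (#|` F n|%:R : R[i])^-1 *: (\sum_(s <- F n) pi s v) @[n --> \oo]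
      --> orthogonal_projection (invariant_vectors pi) v.

End UnitaryRepresentations.

(* Main.v *)
(* Write A_n v for the average of pi(s)v over F_n. The left Folner condition
   gives pi(t) A_n v - A_n v -> 0, and hence only the weak statement
   <A_n v, w - pi(t)w> -> 0 for all w. A finite-dimensional invariant subspace
   E is spanned by the coboundaries w - pi(t)w (w in E) together with their
   orthogonal complement in E, whose vectors are invariant and against which
   A_n v has constant inner product; so for v in E the coordinates of A_n v in
   an orthonormal basis of E converge. Since each A_n is a contraction,
   completeness extends convergence from the span of such subspaces to its
   closure. Any limit u is invariant with v - u orthogonal to the invariant
   vectors, so u is the projection of v. *)
Require Import Defs.
From HB Require Import structures.
From mathcomp Require Import all_boot all_order all_algebra.
From mathcomp Require Import finmap.
From mathcomp Require Import all_classical all_reals all_analysis.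
From mathcomp Require Import complex.

Set Implicit Arguments.
Unset Strict Implicit.
Unset Printing Implicit Defensive.

Import Order.TTheory GRing.Theory Num.Theory.
Import numFieldNormedType.Exports.
Local Open Scope classical_set_scope.
Local Open Scope ring_scope.

(** * Linear spans and subspaces *)

Lemma linear_span_sub (K : numFieldType) (V : lmodType K) (A : set V) :
  A `<=` linear_span A.
Proof.
move=> v Av; exists [:: (1, v)]; split=> [p|].
  by rewrite inE => /eqP ->.
by rewrite big_seq1 scale1r.
Qed.

Definition linear_subspace (K : numFieldType) (V : lmodType K)
    (E : set V) : Prop :=
  E 0 /\ forall a u v, E u -> E v -> E (a *: u + v).

Lemma linear_span_subspace (K : numFieldType) (V : lmodType K) (A : set V) :
  linear_subspace (linear_span A).
Proof.
split; first by exists [::]; split=> //; rewrite big_nil.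
move=> a u v [s [As ->]] [t [At ->]].
exists ([seq (a * p.1, p.2) | p <- s] ++ t); split.
  by move=> p; rewrite mem_cat => /orP[/mapP[q /As Aq ->]|/At].
rewrite big_cat big_map scaler_sumr; congr (_ + _).
by apply: eq_bigr => p _; rewrite scalerA.
Qed.

(** Serves as an induction principle for spans: a property that defines a subspace need only be
    checked on generators. *)
Lemma linear_span_min (K : numFieldType) (V : lmodType K) (A E : set V) :
  linear_subspace E -> A `<=` E -> linear_span A `<=` E.
Proof.
move=> [E0 EZD] AE _ [s [As ->]].
elim: s As => [|p s IHs] As; first by rewrite big_nil.
rewrite big_cons; apply: EZD; first by apply/AE/As/mem_head.
by apply: IHs => q qs; apply: As; rewrite inE qs orbT.
Qed.

Lemma linear_subspace_sum (K : numFieldType) (V : lmodType K) (E : set V)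
    (I : Type) (s : seq I) (a : I -> K) (f : I -> V) :
  linear_subspace E -> (forall i, E (f i)) -> E (\sum_(i <- s) a i *: f i).
Proof.
move=> [E0 EZD] Ef; elim: s => [|i s IHs]; first by rewrite big_nil.
by rewrite big_cons; apply: EZD.
Qed.

(** Indexing the coefficients by position makes them a row vector, so that matrix rank can be
    used. *)
Lemma finite_spanP (K : numFieldType) (V : lmodType K) (s : seq V) (v : V) :
  linear_span [set` s] v ->
  exists a : 'rV[K]_(size s), v = \sum_i a 0 i *: s`_i.
Proof.
pose E := [set w : V | exists a : 'rV[K]_(size s), w = \sum_i a 0 i *: s`_i].
apply: (@linear_span_min _ _ _ E) => /=; first split.
- by exists 0; rewrite big1 // => i _; rewrite mxE scale0r.
- move=> c u w [a ->] [b ->]; exists (c *: a + b).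
  rewrite scaler_sumr -big_split; apply: eq_bigr => i _.
  by rewrite !mxE scalerDl scalerA.
- move=> {}v /= vs.
  have ltv : (index v s < size s)%N by rewrite index_mem.
  exists (delta_mx 0 (Ordinal ltv)); rewrite (bigD1 (Ordinal ltv)) //= big1.
    by rewrite mxE !eqxx scale1r addr0 nth_index.
  by move=> i /negPf neq; rewrite mxE eqxx neq scale0r.
Qed.

(** * Finite orthonormal families *)

Lemma orthonormal_coord (C : numClosedFieldType) (U : lmodType C)
    (dot : {dot U for @Num.conj C}) (s : seq U) (a : 'I_(size s) -> C)
    (k : 'I_(size s)) :
  orthonormal dot s -> dot (\sum_i a i *: s`_i) s`_k = a k.
Proof.
move=> /orthonormalP[us os].
rewrite linear_sumlz (bigD1 k) //= big1 ?addr0.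
  by rewrite linearZl_LR /= os ?mem_nth // eqxx mulr1.
move=> i neq; rewrite linearZl_LR /= os ?mem_nth //.
by rewrite nth_uniq // val_eqE (negPf neq) mulr0.
Qed.

Lemma orthonormal_size (C : numClosedFieldType) (U : lmodType C)
    (dot : {dot U for @Num.conj C}) (s t : seq U) :
  orthonormal dot s -> [set` s] `<=` linear_span [set` t] ->
  (size s <= size t)%N.
Proof.
move=> os st; rewrite leqNgt; apply/negP => lt_ts.
have [M sM] : exists M : 'I_(size s) -> 'rV[C]_(size t),
    forall i : 'I_(size s), s`_i = \sum_j M i 0 j *: t`_j.
  have sM (i : 'I_(size s)) : exists M : 'rV_(size t),
      s`_i = \sum_j M 0 j *: t`_j by apply/finite_spanP/st/mem_nth.
  exact: (fin_all_exists sM).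
pose N := \matrix_i M i.
have : kermx N != 0.
  rewrite -mxrank_eq0 mxrank_ker subn_eq0 -ltnNge.
  exact: leq_ltn_trans (rank_leq_col _) lt_ts.
case/rowV0Pn => a /sub_kermxP aN0 /eqP; apply; apply/rowP => k.
rewrite [RHS]mxE -(orthonormal_coord (a 0) k os).
suff -> : \sum_i a 0 i *: s`_i = 0 by rewrite linear0l.
transitivity (\sum_i \sum_j (a 0 i * N i j) *: t`_j).
  apply: eq_bigr => i _; rewrite sM scaler_sumr; apply: eq_bigr => j _.
  by rewrite scalerA !mxE.
rewrite exchange_big big1 //= => j _; rewrite -scaler_suml.
by move/rowP/(_ j) : aN0; rewrite !mxE => ->; rewrite scale0r.
Qed.

Lemma orthonormal_residual (C : numClosedFieldType) (U : lmodType C)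
    (dot : {dot U for @Num.conj C}) (s : seq U) (x e : U) :
  orthonormal dot s -> e \in s ->
  dot (x - \sum_(i < size s) dot x s`_i *: s`_i) e = 0.
Proof.
move=> os es.
have lte : (index e s < size s)%N by rewrite index_mem.
rewrite -(nth_index 0 es) linearBl /=.
by rewrite (@orthonormal_coord _ _ _ _ _ (Ordinal lte)) // subrr.
Qed.

(** Orthonormal lists in [E] have length at most [size t], so one of maximal length exists. A
    nonzero residual of some [x] in [E], once normalised, would extend it. *)
Lemma orthonormal_basis (C : numClosedFieldType) (U : lmodType C)
    (dot : {dot U for @Num.conj C}) (E : set U) (t : seq U) :
  linear_subspace E -> E `<=` linear_span [set` t] ->
  exists s : seq U,
    [/\ orthonormal dot s, [set` s] `<=` E &
        forall x, E x -> x = \sum_(i < size s) dot x s`_i *: s`_i].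
Proof.
move=> subE Et.
pose P k := `[< exists s : seq U,
  [/\ orthonormal dot s, [set` s] `<=` E & size s = k] >].
have exP : exists k, P k.
  by exists 0%N; apply/asboolP; exists [::].
have leP k : P k -> (k <= size t)%N.
  move=> /asboolP[s [os sE <-]].
  by apply: orthonormal_size os _; apply: subset_trans Et.
case: (ex_maxnP exP leP) => k /asboolP[s [os sE sk]] kmax.
exists s; split=> // x Ex; apply/eqP; rewrite -subr_eq0.
apply/negPn/negP => r0; set r := x - _ in r0.
have Er : E r.
  case: (subE) => E0 EZD; rewrite /r -[_ - _]addrC -scaleN1r.
  apply: EZD => //; apply: linear_subspace_sum => // i.
  exact/sE/mem_nth.
have rs e : e \in s -> dot r e = 0 by exact: orthonormal_residual.
pose c := (sqrtC (dot r r))^-1.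
have c1 : dot (c *: r) (c *: r) = 1.
  rewrite dnormZ normfV ger0_norm ?sqrt_dnorm_ge0 // exprVn sqrtCK mulVf //.
  by rewrite dnorm_eq0.
suff /kmax : P k.+1 by rewrite ltnn.
apply/asboolP; exists (c *: r :: s); split=> [||/=]; last by rewrite sk.
  rewrite -cat1s orthonormal_cat os.
  rewrite /orthonormal /orthogonal /ortho_rec /= c1 eqxx /= !andbT.
  by apply/allP => e es /=; rewrite linearZl_LR /= rs // mulr0.
move=> e /=; rewrite inE => /orP[/eqP ->|/sE //].
by case: subE => E0 EZD; rewrite -[_ *: _]addr0; apply: EZD.
Qed.

Lemma CauchySchwarz_dot (C : numClosedFieldType) (U : lmodType C)
    (dot : {dot U for @Num.conj C}) (u v : U) :
  `|dot u v| ^+ 2 <= dot u u * dot v v.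
Proof.
have [->|v0] := eqVneq v 0; first by rewrite !linear0r normr0 expr0n.
have dv : 0 < dot v v by rewrite dnorm_gt0.
(* Split [u] along [v] and its orthogonal complement; by Pythagoras the inequality amounts to
   dropping the nonnegative term [dot w w * dot v v]. *)
have [c [w [-> wv]]] : exists c w, u = w + c *: v /\ dot w v = 0.
  exists (dot u v / dot v v), (u - (dot u v / dot v v) *: v).
  by rewrite subrK linearBl /= linearZl_LR /= divfK ?subrr // gt_eqF.
rewrite linearDl /= wv add0r linearZl_LR /= normrM exprMn.
rewrite hnormDd /=; last by rewrite linearZr_LR /= wv mulr0.
rewrite dnormZ mulrDl (ger0_norm (ltW dv)) [dot v v ^+ 2]expr2 mulrA.
by rewrite lerDr mulr_ge0 ?dnorm_ge0 // ltW.
Qed.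

(** * Averages of a unitary representation over a finite set *)

Definition average (R : realType) (G : groupType)
    (H : completeNormedModType R[i]) (pi : G -> {linear H -> H})
    (A : {fset G}) (v : H) : H :=
  (#|` A|%:R : R[i])^-1 *: (\sum_(s <- A) pi s v).

Section UnitaryAverages.
Context (R : realType) (G : groupType) (H : completeNormedModType R[i]).
Context (dot : {dot H for @Num.conj R[i]}) (dotE : hilbert_space dot).
Context (pi : G -> {linear H -> H}).
Context (pi_unitary : unitary_representation dot pi).

Implicit Types (A B : {fset G}) (u v w : H) (g t : G).

Lemma norm_dot_le u v : `|dot u v| <= `|u| * `|v|.
Proof.
rewrite -(@ler_pXn2r _ 2%N) ?nnegrE ?mulr_ge0 //.
by rewrite exprMn !dotE CauchySchwarz_dot.
Qed.

Lemma norm_rep g v : `|pi g v| = `|v|.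
Proof.
case: pi_unitary => /(_ g)[_ iso] _ _.
by apply/eqP; rewrite -(@eqrXn2 _ 2%N) // !dotE iso.
Qed.

Lemma dot_repl g u v : dot (pi g u) v = dot u (pi g^-1%g v).
Proof.
case: pi_unitary => /(_ g^-1%g)[_ iso] pi1 piM.
by rewrite -iso -piM mulVg pi1.
Qed.

Lemma averageZD A a u v :
  average pi A (a *: u + v) = a *: average pi A u + average pi A v.
Proof.
rewrite /average; under eq_bigr do rewrite linearP.
by rewrite big_split /= scalerDr -scaler_sumr !scalerA mulrC.
Qed.

Lemma averageB A u v : average pi A (u - v) = average pi A u - average pi A v.
Proof. by rewrite addrC -scaleN1r averageZD scaleN1r addrC. Qed.

Lemma norm_average_sum A v : `|\sum_(s <- A) pi s v| <= #|` A|%:R * `|v|.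
Proof.
apply: le_trans (ler_norm_sum _ _ _) _.
under eq_bigr do rewrite norm_rep.
by rewrite big_const_seq count_predT iter_addr_0 mulr_natl.
Qed.

Lemma norm_average A v : A != fset0 -> `|average pi A v| <= `|v|.
Proof.
rewrite -cardfs_gt0 => A0; rewrite normrZ normfV normr_nat.
by rewrite ler_pdivrMl ?ltr0n // norm_average_sum.
Qed.

Lemma dot_average_invariant A v w : A != fset0 -> invariant_vectors pi w ->
  dot (average pi A v) w = dot v w.
Proof.
rewrite -cardfs_gt0 => A0 inv_w; rewrite linearZl_LR /= linear_sumlz.
under eq_bigr do rewrite /= dot_repl inv_w.
rewrite big_const_seq count_predT iter_addr_0.
rewrite -[dot _ _ *+ _]mulr_natl mulrA mulVf ?mul1r //.
by rewrite pnatr_eq0 -lt0n.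
Qed.

(** Applying [pi t] turns the sum over [A] into the sum over its translate. The terms on the
    intersection cancel, and the two set differences that remain are disjoint, so together they
    count the symmetric difference. *)
Lemma rep_average_sub A t v :
  `|pi t (average pi A v) - average pi A v|
    <= #|` fsymdiff A (left_translate t A)|%:R / #|` A|%:R * `|v|.
Proof.
case: (pi_unitary) => _ pi1 piM.
have -> : pi t (average pi A v) =
    (#|` A|%:R)^-1 *: \sum_(s <- left_translate t A) pi s v.
  rewrite /average linearZ linear_sum /left_translate big_imfset /=.
    by congr (_ *: _); apply: eq_bigr => s _; rewrite piM.
  by move=> x y _ _ /mulgI.
set B := left_translate t A.
rewrite /average -scalerBr normrZ normfV normr_nat mulrAC mulrC.
rewrite ler_wpM2r ?invr_ge0 //.
have split_sum (X Y : {fset G}) : \sum_(s <- X) pi s v =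
    \sum_(s <- (X `&` Y)%fset) pi s v + \sum_(s <- (X `\` Y)%fset) pi s v.
  rewrite (big_fsetID _ (mem Y)) /=; congr (_ + _); apply: eq_fbigl => s.
    by rewrite !inE.
  by rewrite !inE andbC.
rewrite (split_sum B A) (split_sum A B) fsetIC opprD addrACA subrr add0r.
apply: le_trans (ler_normB _ _) _.
apply: le_trans (lerD (norm_average_sum _ _) (norm_average_sum _ _)) _.
rewrite -mulrDl ler_wpM2r // -natrD ler_nat addnC.
have /leqifP := leq_card_fsetU (A `\` B)%fset (B `\` A)%fset.
suff -> : [disjoint (A `\` B) & (B `\` A)]%fset by move=> /eqP ->.
by apply/fdisjointP => x; rewrite !inE => /andP[/negPf -> _]; rewrite andbF.
Qed.

Lemma cvg_dot (f : nat -> H) (l w : H) :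
  f n @[n --> \oo] --> l -> (dot (f n) w : R[i]^o) @[n --> \oo] --> dot l w.
Proof.
move=> fl; apply/cvgrPdist_lt => e e0.
(* Adding 1 keeps the divisor positive when [w] is zero. *)
have w1 : 0 < `|w| + 1 by rewrite ltr_wpDl.
have /cvgrPdist_lt /(_ (e / (`|w| + 1))) := fl.
rewrite divr_gt0 // => /(_ isT); apply: filterS => n lt_n.
rewrite -linearBl /=; apply: le_lt_trans (norm_dot_le _ _) _.
apply: (@le_lt_trans _ _ (`|l - f n| * (`|w| + 1))).
  by rewrite ler_wpM2l // lerDl.
by rewrite -ltr_pdivlMr.
Qed.

(** * Averages along a left Følner sequence *)

Section FolnerAverages.
Context (F : nat -> {fset G}) (F_folner : left_folner R F).

Lemma folner_average_rep t v :
  (pi t (average pi (F n) v) - average pi (F n) v) @[n --> \oo] --> (0 : H).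
Proof.
apply/cvgrPdist_lt => e e0.
have v1 : 0 < `|v| + 1 by rewrite ltr_wpDl.
have d0 : 0 < e / (`|v| + 1) by rewrite divr_gt0.
(* The Følner ratios converge in [R], whereas norms in [H] take values in [R[i]]; the positive
   tolerance is real, so it is replaced by its real part. *)
have dE : e / (`|v| + 1) = (complex.Re (e / (`|v| + 1)))%:C%C.
  by rewrite RRe_real // gtr0_real.
case: F_folner => _ /(_ t) /cvgrPdist_lt /(_ (complex.Re (e / (`|v| + 1)))).
rewrite -ltcR -dE => /(_ d0); apply: filterS => n.
rewrite sub0r normrN ger0_norm ?divr_ge0 // -ltcR -dE => lt_n.
rewrite sub0r normrN; apply: le_lt_trans (rep_average_sub _ _ _) _.
move: lt_n; rewrite ltr_pdivlMr // rmorphM fmorphV !rmorph_nat.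
apply: le_lt_trans.
by rewrite ler_wpM2l ?divr_ge0 // lerDl.
Qed.

Lemma folner_average_limit v u : average pi (F n) v @[n --> \oo] --> u ->
  orthogonal_projection dot (invariant_vectors pi) v = u.
Proof.
move=> Au.
have Fn0 n : F n != fset0 by case: F_folner.
have inv_u : invariant_vectors pi u.
  move=> t; apply/eqP; rewrite -subr_eq0; apply/eqP.
  have piA : pi t (average pi (F n) v) @[n --> \oo] --> pi t u.
    apply/cvgrPdist_lt => e e0; move/cvgrPdist_lt/(_ _ e0): Au.
    by apply: filterS => n; rewrite -linearB norm_rep.
  by apply: cvg_unique (cvgB piA Au) (folner_average_rep t v).
have orth w : invariant_vectors pi w -> dot (v - u) w = 0.
  move=> inv_w; apply/eqP; rewrite linearBl /= subr_eq0 eq_sym; apply/eqP.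
  have c1 := cvg_dot (w := w) Au.
  have c2 : (dot (average pi (F n) v) w : R[i]^o) @[n --> \oo]
      --> (dot v w : R[i]^o).
    by under eq_cvg do rewrite dot_average_invariant //; exact: cvg_cst.
  by apply: (cvg_unique _ c1 c2); exact: norm_hausdorff.
(* To evaluate [get], a competitor [u'] is excluded: [u' - u] is invariant and equals
   [(v - u) - (v - u')], hence is orthogonal to itself. *)
apply: get_unique => // u' [inv_u' orth'].
have inv_d : invariant_vectors pi (u' - u).
  by move=> t; rewrite linearB inv_u inv_u'.
apply/eqP; rewrite -subr_eq0 -(dnorm_eq0 dot).
rewrite -{1}(subrKA v) -opprB [- (v - u') + _]addrC linearBl /=.
by rewrite orth // orth' // subrr.
Qed.

Definition cvg_coef v : set H :=
  [set w | cvg ((dot (average pi (F n) v) w : R[i]^o) @[n --> \oo])].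

Lemma cvg_coef_subspace v : linear_subspace (cvg_coef v).
Proof.
rewrite /cvg_coef; split=> [|a w w' cw cw'] /=.
  by under eq_is_cvg do rewrite linear0r; exact: is_cvg_cst.
under eq_is_cvg do rewrite linearDr /= linearZr_LR /=.
apply: (@is_cvgD R[i] R[i]^o nat (\oo)%classic).
  exact: (@is_cvgZr R[i] R[i]^o nat (\oo)%classic _ (a^*) _ cw).
exact: cw'.
Qed.

Lemma cvg_coef_invariant v w : invariant_vectors pi w -> cvg_coef v w.
Proof.
case: F_folner => Fn0 _ inv_w.
rewrite /cvg_coef /=; under eq_is_cvg do rewrite dot_average_invariant //.
exact: is_cvg_cst.
Qed.

(** Moving [pi t] to the other side of the inner product gives [pi t^-1], and asymptotic invariance
    of the averages under [t^-1] applies. *)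
Lemma cvg_coef_coboundary v w t : cvg_coef v (w - pi t w).
Proof.
case: pi_unitary => _ pi1 piM.
have tE u : dot u (w - pi t w) = dot (u - pi t^-1%g u) w.
  by rewrite linearBr linearBl /= dot_repl invgK.
apply/cvg_ex; exists (- dot 0 w).
under eq_cvg do rewrite tE -opprB linearNl /=.
apply: cvgN; exact: cvg_dot (folner_average_rep _ _).
Qed.

Lemma folner_average_fin_dim (E : set H) (s : seq H) v :
  linear_subspace E -> E `<=` linear_span [set` s] ->
  (forall t w, E w -> E (pi t w)) -> E v ->
  cvg (average pi (F n) v @[n --> \oo]).
Proof.
move=> subE Es piE Ev; have [E0 EZD] := subE.
(* The span of the coboundaries of [E]. *)
pose D := linear_span [set x | exists w t, E w /\ x = w - pi t w].
have subD : linear_subspace D := linear_span_subspace _.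
have DE : D `<=` E.
  apply: linear_span_min => // _ [w [t [Ew ->]]].
  by rewrite addrC -scaleN1r; apply: EZD => //; apply: piE.
have DW : D `<=` cvg_coef v.
  apply: linear_span_min; first exact: cvg_coef_subspace.
  by move=> _ [w [t [_ ->]]]; exact: cvg_coef_coboundary.
have [d [od dD dE]] := orthonormal_basis dot subD (subset_trans DE Es).
have EW : E `<=` cvg_coef v.
  (* Here [p] is the orthogonal projection of [w] onto [D]. Its coefficients converge by [DW]; the
     remainder [r] will be shown invariant, so its coefficients are constant. *)
  move=> w Ew; pose p := \sum_(i < size d) dot w d`_i *: d`_i.
  have Dp : D p by apply: linear_subspace_sum => // i; apply/dD/mem_nth.
  pose r := w - p.
  have Er : E r by rewrite /r addrC -scaleN1r; apply: EZD => //; apply: DE.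
  have rD x : D x -> dot r x = 0.
    move=> /dE ->; rewrite linear_sumr big1 //= => i _.
    by rewrite linearZr_LR /= orthonormal_residual ?mulr0 // mem_nth.
  suff inv_r : invariant_vectors pi r.
    rewrite -(subrK p w) -[w - p]scale1r.
    by apply: (cvg_coef_subspace v).2; [exact: cvg_coef_invariant|exact: DW].
  have rDt t : dot r (r - pi t r) = 0.
    by apply/rD/linear_span_sub; exists r, t.
  (* Expand the squared norm of [r - pi t r]. The part against [r] vanishes by [rDt t]; the part
     against [pi t r], after transposing [pi t], vanishes by [rDt t^-1]. *)
  move=> t; apply/esym/eqP; rewrite -subr_eq0 -(dnorm_eq0 dot).
  rewrite linearBl /= rDt sub0r dot_repl linearB /=.
  case: pi_unitary => _ pi1 piM; rewrite -piM mulVg pi1 -opprB linearNr.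
  by rewrite /= rDt !oppr0.
have [e [oe eE eP]] := orthonormal_basis dot subE Es.
have EA n : E (average pi (F n) v).
  rewrite /average scaler_sumr; apply: linear_subspace_sum => // g; exact: piE.
(* The averages stay in [E], so they are finite sums over the orthonormal basis [e], and norm
   convergence follows from that of each coordinate. *)
under eq_is_cvg => n do rewrite (eP _ (EA n)).
apply/cvg_ex.
exists (\sum_(i < size e)
  lim ((dot (average pi (F n) v) e`_i : R[i]^o) @[n --> \oo]) *: e`_i).
apply: cvg_big => [|i _]; first exact: add_continuous.
by apply: cvgZl; apply/EW/eE/mem_nth.
Qed.

End FolnerAverages.
End UnitaryAverages.

(** * Cyclic spans and passage to the closure *)

Lemma cyclic_span_rep (R : realType) (G : groupType)
    (H : completeNormedModType R[i]) (dot : {dot H for @Num.conj R[i]})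
    (pi : G -> {linear H -> H}) t v w :
  unitary_representation dot pi ->
  cyclic_span pi v w -> cyclic_span pi v (pi t w).
Proof.
case=> _ _ piM; pose E := [set w : H | cyclic_span pi v (pi t w)].
have [V0 VZD] : linear_subspace (cyclic_span pi v) := linear_span_subspace _.
(* The preimage of the cyclic span under [pi t] is a subspace, and it contains each generator
   [pi g v] because [pi t] sends it to [pi (t * g) v]. *)
apply: (@linear_span_min _ _ _ E); first split.
- by rewrite /E /= linear0.
- by move=> a x y; rewrite /E /= linearP; apply: VZD.
- move=> _ [g _ <-]; rewrite /E /= -piM; apply: linear_span_sub.
  by exists (t * g)%g.
Qed.

Theorem corollary1p1 (R : realType) (G : groupType)
    (G_countable : countable [set: G]) (G_amenable : amenable R G)
    (H : completeNormedModType R[i]) (dot : {dot H for @Num.conj R[i]})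
    (H_hilbert : hilbert_space dot)
    (pi : G -> {linear H -> H}) (pi_unitary : unitary_representation dot pi)
    (pi_pure_point : pure_point_spectrum pi)
    (F : nat -> {fset G}) (F_folner : left_folner R F) :
  strong_sequence dot pi F.
Proof.
pose S := [set v : H | cvg (average pi (F n) v @[n --> \oo])].
have subS : linear_subspace S.
  rewrite /S; split=> [|a u v Su Sv] /=.
    under eq_is_cvg do
      rewrite /average (eq_bigr _ (fun s _ => linear0 _)) big1 // scaler0.
    exact: is_cvg_cst.
  under eq_is_cvg do rewrite averageZD.
  by apply: is_cvgD => //; exact: is_cvgZr.
have fdS : linear_span [set v | finite_dimensional (cyclic_span pi v)] `<=` S.
  apply: linear_span_min => // v [s vs].
  have [_ pi1 _] := pi_unitary.
  apply: (folner_average_fin_dim H_hilbert pi_unitary F_folner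
    (E := cyclic_span pi v) (s := s)).
  - exact: linear_span_subspace.
  - by rewrite vs.
  - by move=> t w; exact: cyclic_span_rep pi_unitary.
  - by apply: linear_span_sub; exists 1%g.
move=> v; have [u Au] : exists u : H, average pi (F n) v @[n --> \oo] --> u;
    last first.
  by rewrite (folner_average_limit H_hilbert pi_unitary F_folner Au).
(* By completeness it is enough to find, for each [e], one centre whose [e]-ball eventually contains
   the averages of [v]. *)
apply/cvg_ex/cauchy_cvgP/cauchy_exP => e e0.
have e20 : 0 < e / 2 by rewrite divr_gt0.
have : closure (linear_span [set v | finite_dimensional (cyclic_span pi v)]) v.
  by rewrite pi_pure_point.
move=> /(_ (ball v (e / 2))) [|u [/fdS /cvg_ex[x Ax]]].
  exact: nbhsx_ballx.
rewrite -ball_normE /= => vu.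
(* The centre is the limit [x] of the averages of a nearby [u]: half of [e] bounds the distance from
   [x] to those averages, the other half bounds the average of [u - v] by contraction. *)
exists x; move/cvgrPdist_lt/(_ _ e20): Ax; apply: filterS => n xn.
rewrite /= [e]splitr.
have -> : x - average pi (F n) v =
    (x - average pi (F n) u) + average pi (F n) (u - v).
  by rewrite averageB addrA subrK.
apply: le_lt_trans (ler_normD _ _) _; apply: ltrD => //.
apply: le_lt_trans vu; rewrite distrC.
by apply: norm_average; [exact: H_hilbert|exact: pi_unitary|case: F_folner].
Qed.
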